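(* Let $\mathcal{H}$ be an infinite-dimensional separable real Hilbert space, let $\mu^{f}=\mathcal{N}(m^{f},\mathrm{P}^{f})$ be a ($\sigma$-additive) Gaussian probability measure on the Borel sets of $\mathcal{H}$ with mean $m^{f}\in\mathcal{H}$ and covariance operator $\mathrm{P}^{f}$, and let $\mathrm{R}$ be a bounded, symmetric, positive semidefinite linear operator on $\mathcal{H}$. Assume that $\mathrm{P}^{f}$ and $\mathrm{R}$ commute, i.e. $\mathrm{P}^{f}\mathrm{R}-\mathrm{R}\mathrm{P}^{f}=0$. Let the data likelihood be $$d(y|x)=\kappa\exp\left(-\tfrac{1}{2}|y-x|_{\mathrm{R}^{-1}}^{2}\right),\qquad x,y\in\mathcal{H},$$ where $\kappa>0$ is a constant. If $\mathrm{R}$ does not have positive lower bound, then the set $$A=\left\{y\in\mathcal{H}:\ \int_{\mathcal{H}}d(y|x)\,d\mu^{f}(x)=0\right\}$$ is dense in $\mathcal{H}$.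
   Context: The inner product on $\mathcal{H}$ is $\langle\cdot,\cdot\rangle$ and the norm is $|u|=\sqrt{\langle u,u\rangle}$. A bounded linear operator $\mathrm{R}$ on $\mathcal{H}$ has positive lower bound if there is $\alpha>0$ such that $\langle\mathrm{R}u,u\rangle\ge\alpha|u|^{2}$ for all $u\in\mathcal{H}$. The covariance $\mathrm{P}^{f}$ of a $\sigma$-additive Gaussian measure on $\mathcal{H}$ is symmetric, positive semidefinite and trace class; $\mathrm{R}$ (the data error covariance) is not required to be trace class. With $\mathrm{R}^{1/2}$ the positive semidefinite square root of $\mathrm{R}$ and $\mathrm{R}^{1/2}(\mathcal{H})$ its image, $$|x|_{\mathrm{R}^{-1}}^{2}=\begin{cases}\langle\mathrm{R}^{-1/2}x,\mathrm{R}^{-1/2}x\rangle & \text{if }x\in\mathrm{R}^{1/2}(\mathcal{H}),\\ \infty & \text{if }x\notin\mathrm{R}^{1/2}(\mathcal{H}),\end{cases}$$ and $\exp(-\infty)=0$ by convention. For $x\in\mathrm{R}^{1/2}(\mathcal{H})$, $\mathrm{R}^{-1/2}x$ denotes the preimage of $x$ under $\mathrm{R}^{1/2}$ (the one of minimal norm, if $\mathrm{R}$ is not injective). *)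

(* Defs.v *)
From HB Require Import structures.
From mathcomp Require Import all_boot all_order all_algebra.
From mathcomp Require Import all_classical all_reals all_analysis.
Import Order.TTheory GRing.Theory Num.Theory.
Import numFieldNormedType.Exports.

Set Implicit Arguments.
Unset Strict Implicit.
Unset Printing Implicit Defensive.

Local Open Scope classical_set_scope.
Local Open Scope ring_scope.

(* A real Hilbert space is given by a Banach space [H], with norm [`|u|],
   together with an inner product [ip] that induces this norm. *)
Definition induces_norm (R : realType) (H : completeNormedModType R)
    (ip : {dot H for idfun}) : Prop :=
  forall u : H, `|u| = Num.sqrt (ip u u).

Definition separable (T : topologicalType) : Prop :=
  exists2 D : set T, countable D & dense D.

Definition finite_dimensional (R : realType) (H : lmodType R) : Prop :=
  exists (n : nat) (e : 'I_n -> H),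
    forall x : H, exists c : 'I_n -> R, x = \sum_(i < n) c i *: e i.

Definition borel (T : ptopologicalType) := g_sigma_algebraType (@open T).

Section operators.
Variables (R : realType) (H : completeNormedModType R).
Variable ip : {dot H for idfun}.

Definition bounded_op (T : H -> H) : Prop :=
  exists M : R, forall u, `|T u| <= M * `|u|.

Definition symmetric_op (T : H -> H) : Prop :=
  forall u v, ip (T u) v = ip u (T v).

Definition psd_op (T : H -> H) : Prop := forall u, 0 <= ip (T u) u.

Definition has_positive_lower_bound (T : H -> H) : Prop :=
  exists2 alpha : R, 0 < alpha & forall u, ip (T u) u >= alpha * `|u| ^+ 2.

Definition is_psd_sqrt (T S : H -> H) : Prop :=
  [/\ linear S, bounded_op S, symmetric_op S, psd_op S
    & forall u, S (S u) = T u].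

(* The square root of a bounded symmetric positive semidefinite [T] exists and
   is unique, so that the default value 0 plays no role for such [T]. *)
Definition sqrt_op (T : H -> H) : H -> H := xget (fun=> 0) (is_psd_sqrt T).

(* The preimage of [x] under [sqrt_op T] of minimal norm; it exists and is
   unique for [x] in the range of [sqrt_op T], and is only used there. *)
Definition inv_sqrt_op (T : H -> H) (x : H) : H :=
  xget 0 [set z | sqrt_op T z = x /\
                  forall w, sqrt_op T w = x -> `|z| <= `|w|].

Definition weighted_sqnorm (T : H -> H) (x : H) : \bar R :=
  if `[< range (sqrt_op T) x >]
  then (ip (inv_sqrt_op T x) (inv_sqrt_op T x))%:E else +oo%E.

(* [expeR -oo = 0] by definition of [expeR]. *)
Definition likelihood (kappa : R) (T : H -> H) (y x : H) : \bar R :=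
  (kappa%:E * expeR ((- 2^-1)%:E * weighted_sqnorm T (y - x)%R))%E.

End operators.

(* The normal law on the real line with mean [a] and standard deviation [s];
   the library's [normal_prob a s] is not meant to be used for [s = 0], where
   the law is the Dirac mass at [a]. *)
Definition gaussian_law (R : realType) (a s : R) : set R -> \bar R :=
  if s == 0 then dirac a else normal_prob a s.

Section gaussian_measure.
Variables (R : realType) (H : completeNormedModType R).
Variable ip : {dot H for idfun}.
Variable mu : probability (borel H) R.

Definition is_gaussian : Prop :=
  forall u : H, exists a s : R, 0 <= s /\
    forall B : set R, measurable B ->
      pushforward mu (fun x : borel H => ip u x) B = gaussian_law a s B.

Definition has_mean (m : H) : Prop :=
  forall u : H, ('E_mu[fun x : borel H => ip u x] = (ip u m)%:E)%E.

Definition has_covariance (P : H -> H) : Prop :=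
  forall u v : H,
    covariance mu (fun x : borel H => ip u x) (fun x : borel H => ip v x)
    = (ip (P u) v)%:E.

End gaussian_measure.

(* Main.v *)
Require Import Defs.
From HB Require Import structures.
From mathcomp Require Import all_boot all_order all_algebra.
From mathcomp Require Import all_classical all_reals all_analysis.
Import Order.TTheory GRing.Theory Num.Theory.
Import numFieldNormedType.Exports.
Import HBNNSimple.

Local Open Scope classical_set_scope.
Local Open Scope ring_scope.

(** The integral vanishes at [y] as soon as [mu] does not charge
    [y - W], where [W] is the range of the square root of [Rop]. The range [W]
    lies in a larger Borel subspace that is still proper. As [Rop] has no
    positive lower bound, there is an unbounded sequence [g] along which
    [ip (Rop (g n)) (g n) <= 1]
    ([unbounded_form_sublevel]). For such a [g], the vectors [x] whose pairings
    [ip x (g n)] stay bounded in [n] form a subspace [V]. It contains [W] by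
    the Cauchy-Schwarz inequality, because the square root maps the [g n] into
    the unit ball ([range_sqrt_sub_bounded_pairing]); it is a countable union
    of closed sets; and it is proper by the uniform boundedness principle,
    because [g] is unbounded ([bounded_pairing_proper]).

    A probability measure charges few translates of a proper subspace
    ([dense_null_translates]). Fix [v] outside [V]. For any [y], the sets
    [y + t v - V], with [t] real, are pairwise disjoint, so only countably many
    of them have positive mass, whereas every interval of parameters [t] is
    uncountable. Points [y + t v] arbitrarily close to [y] thus satisfy
    [mu (y + t v - V) = 0], and at these points the likelihood is zero
    almost everywhere. *)

(** * Measures *)

(** Stated for an arbitrary nonnegative [f], so that it applies to the
    likelihood without a study of the Borel structure of the range of a square
    root: the integral is a supremum over the simple functions below [f], and
    each of these is measurable and vanishes outside [N]. *)
Lemma integral_eq0_off_null_set d (T : measurableType d) (R : realType)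
    (mu : {measure set T -> \bar R}) (N : set T) (f : T -> \bar R) :
  measurable N -> mu N = 0%E -> (forall x, 0 <= f x)%E ->
  (forall x, ~ N x -> f x = 0%E) -> (\int[mu]_x f x = 0)%E.
Proof.
move=> mN N0 f0 fN; rewrite ge0_integralTE//; apply/eqP; rewrite eq_le.
apply/andP; split; last first.
  by apply: ereal_sup_ubound; exists nnsfun0 => //; exact: sintegral0.
apply: ge_ereal_sup => _ [h hf <-].
rewrite -integralT_nnsfun (ge0_negligible_integral mN)//.
- rewrite integral0_eq// => x [_ /fN fx0].
  apply/eqP; rewrite eq_le; apply/andP; split; first by rewrite -fx0; exact: hf.
  by rewrite lee_fin.
- by apply/measurable_realfun.measurable_EFinP; exact: measurable_funPT.
- by move=> x _; rewrite lee_fin.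
Qed.

(** At most [k + 1] of the disjoint sets can have mass at least
    [1 / (k + 1)], since their masses add up to at most 1. *)
Lemma countable_charged d (T : measurableType d) (R : realType)
    (mu : probability T R) (I : choiceType) (E : I -> set T) :
  (forall i, measurable (E i)) -> trivIset [set: I] E ->
  countable [set i | mu (E i) != 0%E].
Proof.
move=> mE tE.
have fin k : finite_set [set i | (k.+1%:R^-1%:E <= mu (E i))%E].
  (* [k + 2] sets of mass at least [1 / (k + 1)] have total mass above 1. *)
  apply: contrapT => /(infinite_set_fset k.+2)[B BA kB].
  have := @probability_le1 _ _ _ mu _
    (fin_bigcup_measurable (finite_fset B) (fun i _ => mE i)).
  apply/negP; rewrite -ltNge measure_fin_bigcup//; last first.
    exact: sub_trivIset tE.
  apply: lt_le_trans (lee_fsum (finite_fset B) BA).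
  rewrite -fsbig_seq//= sumEFin big_const_seq count_predT iter_addr addr0 lte_fin.
  by rewrite -[_ *+ size _]mulr_natl ltr_pdivlMr// mul1r ltr_nat.
apply: (@sub_countable _ _ _
  (\bigcup_k [set i | (k.+1%:R^-1%:E <= mu (E i))%E])); last first.
  by apply: bigcup_countable => // k _; exact: finite_set_countable.
apply: subset_card_le => i /= mui.
have fi : mu (E i) \is a fin_num by exact: fin_num_measure.
have mu0 : 0 < fine (mu (E i)).
  by rewrite fine_gt0// lt0e mui measure_ge0 ltey_eq fi.
have [k _ /= kx] := near_infty_natSinv_lt (PosNum mu0).
exists k => //=; rewrite -(fineK fi) lee_fin ltW//.
by apply: kx => /=.
Qed.

(** Along a line whose direction [v] is not in [V], the translates of [V] are
    pairwise disjoint: a point common to two of them would put a nonzero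
    multiple of [v] in [V]. Countably many are charged, and countable sets of
    parameters have Lebesgue measure zero, hence contain no interval. *)
Lemma dense_null_translates (R : realType) (H : normedModType R)
    d (T : measurableType d) (mu : probability T R) (X : T -> H) (V : set H) :
  (forall x y, V x -> V y -> V (x - y)) -> (forall a x, V x -> V (a *: x)) ->
  V != setT -> (forall y, measurable [set x | V (y - X x)]) ->
  dense [set y | mu [set x | V (y - X x)] = 0%E].
Proof.
move=> VB VZ /setTPn[v Vv] mV O [y Oy] openO.
pose E t := [set x | V (y + t *: v - X x)].
have tE : trivIset [set: R] E.
  apply/trivIsetP => s t _ _ st; apply/seteqP; split => // x [/= Vs Vt].
  apply: Vv; have := VB _ _ Vs Vt.
  rewrite opprB addrA subrK opprD addrACA subrr add0r -scalerBl.
  move=> /(VZ (s - t)^-1).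
  by rewrite scalerA mulVf ?scale1r// subr_eq0.
have ctE : countable [set t | mu (E t) != 0%E].
  by apply: countable_charged => // t; exact: mV.
have : nbhs (0 : R) [set t | O (y + t *: v)].
  have cont : {for 0, continuous (fun t : R => y + t *: v)}.
    apply: cvgD; first exact: cvg_cst.
    by apply: cvgZl; exact: cvg_id.
  by apply: cont; rewrite /= scale0r addr0; exact: open_nbhs_nbhs.
move=> /nbhs_ballP[e /= e0 eO].
have [t [te Et]] : exists t, `]0, e[%classic t /\ mu (E t) = 0%E.
  apply: contrapT => /forallNP noE.
  have := @countable_lebesgue_measure0 R `]0, e[%classic.
  rewrite lebesgue_measure_itv/= lte_fin e0 -EFinB subr0 => e_eq0.
  suff /e_eq0[/eqP] : countable `]0, e[%classic by rewrite gt_eqF.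
  apply: sub_countable ctE; apply: subset_card_le => t te /=.
  by apply/eqP => Et; exact: (noE t).
exists (y + t *: v); split=> //; apply: eO.
move: te; rewrite /= in_itv/= /ball/= sub0r normrN => /andP[t0 te].
by rewrite gtr0_norm.
Qed.

(** * Hilbert space geometry *)

Section hilbert.
Variables (R : realType) (H : completeNormedModType R).
Variable ip : {dot H for idfun}.
Hypothesis Hip : induces_norm ip.

Lemma ipC u v : ip u v = ip v u.
Proof. by rewrite (hermC ip) /= expr0 mul1r. Qed.

Lemma ipZl a u v : ip (a *: u) v = a * ip u v.
Proof. exact: linearZl_LR. Qed.

Lemma ipZr a u v : ip u (a *: v) = a * ip u v.
Proof. exact: linearZr_LR. Qed.

Lemma ipDl u v w : ip (u + v) w = ip u w + ip v w.
Proof. exact: linearDl. Qed.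

Lemma ipBl u v w : ip (u - v) w = ip u w - ip v w.
Proof. exact: linearBl. Qed.

Lemma ipBr u v w : ip u (v - w) = ip u v - ip u w.
Proof. exact: linearBr. Qed.

Lemma ip_ge0 u : 0 <= ip u u.
Proof.
have [->|u0] := eqVneq u 0; first by rewrite linear0l.
exact/ltW/neq0_dnorm_gt0.
Qed.

Lemma ip_norm u : ip u u = `|u| ^+ 2.
Proof. by rewrite Hip sqr_sqrtr// ip_ge0. Qed.

Lemma cauchy_schwarz u v : `|ip u v| <= `|u| * `|v|.
Proof.
have [->|v0] := eqVneq v 0; first by rewrite linear0r !normr0 mulr0.
have vv0 : 0 < ip v v by exact: neq0_dnorm_gt0.
rewrite -(ler_pXn2r (n := 2))// ?nnegrE ?mulr_ge0//.
rewrite exprMn -!ip_norm real_normK ?num_real//.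
(* Subtracting from [u] its orthogonal projection on the line of [v] leaves a
   vector of squared norm [ip u u - (ip u v)^2 / ip v v]. *)
have := ip_ge0 (u - (ip u v / ip v v) *: v).
rewrite ipBl !ipBr !ipZl !ipZr (ipC v u).
rewrite divfK ?gt_eqF// subrr subr0 mulrAC -expr2.
by rewrite subr_ge0 ler_pdivrMr.
Qed.

Lemma continuous_ip v : continuous (fun u => ip u v).
Proof.
move=> u; apply/cvgrPdist_le => e e0; near=> x.
rewrite -ipBl (le_trans (cauchy_schwarz _ _))//.
rewrite (@le_trans _ _ (`|u - x| * (`|v| + 1)))//.
  by rewrite ler_wpM2l// lerDl.
rewrite -ler_pdivlMr ?ltr_wpDl//.
near: x; apply: cvgr_dist_le; first exact: cvg_id.
by rewrite divr_gt0// ltr_wpDl.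
Unshelve. all: by end_near. Qed.

(** For a suitable [g] this encloses the range of a square root in a subspace
    that is visibly Borel. *)
Definition bounded_pairing (g : nat -> H) : set H :=
  [set x | exists M : R, forall n, `|ip x (g n)| <= M].

Lemma bounded_pairingB g x y : bounded_pairing g x -> bounded_pairing g y ->
  bounded_pairing g (x - y).
Proof.
move=> [M xM] [N yN]; exists (M + N) => n.
by rewrite ipBl (le_trans (ler_normB _ _))// lerD.
Qed.

Lemma bounded_pairingZ g a x : bounded_pairing g x -> bounded_pairing g (a *: x).
Proof.
move=> [M xM]; exists (`|a| * M) => n.
by rewrite ipZl normrM ler_wpM2l.
Qed.

(** By continuity of the inner product the set is a countable union, over the
    integer bounds [k], of closed sets. *)
Lemma measurable_bounded_pairing g y :
  measurable [set x : borel H | bounded_pairing g (y - x)].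
Proof.
have -> : [set x : borel H | bounded_pairing g (y - x)] =
    \bigcup_k \bigcap_n [set x : H | `|ip (y - x) (g n)| <= k%:R].
  apply/seteqP; split => x /=.
    move=> [M xM]; exists (Num.bound M) => // n _ /=.
    by rewrite (le_trans (xM n))// ltW// archi_boundP// (le_trans _ (xM 0%N)).
  by move=> [k _ xk]; exists k%:R => n; exact: xk.
apply: bigcup_measurable => k _.
rewrite -[X in measurable X]setCK; apply: measurableC; apply: sub_sigma_algebra.
apply: closed_openC; apply: closed_bigI => n _.
apply: (@preimage_closed _ _ (fun x : H => `|ip (y - x) (g n)|)
  [set r : R | r <= k%:R]); last exact: closed_le.
move=> x _; apply: cvg_norm.
apply: (@cvg_comp _ _ _ (fun x : H => y - x) (fun u => ip u (g n))).
  by apply: cvgB; [exact: cvg_cst|exact: cvg_id].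
exact: continuous_ip.
Qed.

(** If the pairings were bounded at every point, Banach-Steinhaus would bound
    the norms of the functionals [ip ^~ (g n)], that is, the norms of the
    [g n]. *)
Lemma bounded_pairing_proper g :
  (forall M : R, exists n, M < `|g n|) -> bounded_pairing g != setT.
Proof.
move=> gM; apply/eqP => gT.
pose F := range (fun n u => ip u (g n)).
have [||M FM] := @Banach_Steinhauss R H R F _ _ 1.
- move=> _ [n _ <-]; split.
    move=> r; exists (r * `|g n|) => x xr.
    by rewrite (le_trans (cauchy_schwarz _ _))// ler_wpM2r.
  by move=> a x y; rewrite ipDl ipZl.
- move=> x; have : bounded_pairing g x by rewrite gT.
  by move=> [M xM]; exists M => _ [n _ <-].
have [n] := gM `|M|; apply/negP; rewrite -leNgt.
have [->|gn0] := eqVneq (g n) 0; first by rewrite normr0.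
have ngn0 : `|g n| != 0 by rewrite normr_eq0.
(* The functional [ip ^~ (g n)] attains its norm at [g n / |g n|]. *)
have := FM _ (ex_intro2 _ _ n I erefl) (`|g n|^-1 *: g n).
rewrite normrZ normfV normr_id mulVf// lexx => /(_ isT).
rewrite ipZl ip_norm expr2 mulKf// normr_id => /le_trans; apply.
exact: ler_norm.
Qed.

(** If a vector of norm [n + 1] with form value at most 1 did not exist, then
    by homogeneity [(n + 1)^-2] would be a lower bound of the form. *)
Lemma unbounded_form_sublevel (T : {linear H -> H}) :
  ~ has_positive_lower_bound ip T ->
  exists g : nat -> H, (forall M : R, exists n, M < `|g n|) /\
    forall n, ip (T (g n)) (g n) <= 1.
Proof.
move=> nlb.
suff /choice[g gP] : forall n : nat, exists g : H,
    `|g| = n.+1%:R /\ ip (T g) g <= 1.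
  exists g; split=> [M|n]; last exact: (gP n).2.
  exists (Num.bound M); rewrite (gP _).1.
  have [M0|M0] := leP 0 M; last by rewrite (lt_le_trans M0).
  by rewrite (lt_trans (archi_boundP M0))// ltr_nat.
move=> n; apply: contrapT => /forallNP ng; apply: nlb.
exists (n.+1%:R ^- 2); first by rewrite invr_gt0 exprn_gt0.
move=> u; have [->|u0] := eqVneq u 0.
  by rewrite linear0r normr0 expr0n/= mulr0.
have nu0 : 0 < `|u| by rewrite normr_gt0.
pose a : R := n.+1%:R / `|u|.
have a0 : 0 < a by rewrite divr_gt0.
rewrite leNgt; apply/negP => ltu; apply: (ng (a *: u)); split.
  by rewrite normrZ gtr0_norm// divfK// gt_eqF.
rewrite [T _]linearZ ipZl ipZr mulrA -expr2.
rewrite mulrC -ler_pdivlMr ?exprn_gt0// mul1r (le_trans (ltW ltu))//.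
by rewrite /a expr_div_n invf_div mulrC.
Qed.

(** For a square root [S] of [T], symmetry moves [S] to the other side:
    [ip (S w) (g n) = ip w (S (g n))], and the squared norm of [S (g n)] is
    [ip (T (g n)) (g n) <= 1]. *)
Lemma range_sqrt_sub_bounded_pairing (T : H -> H) (g : nat -> H) :
  (forall n, ip (T (g n)) (g n) <= 1) ->
  range (sqrt_op ip T) `<=` bounded_pairing g.
Proof.
move=> Tg _ [w _ <-]; rewrite /sqrt_op.
case: xgetP => [S _ [_ _ Ssym _ SS]|_]; last first.
  (* For a [T] without square root, [sqrt_op] is the zero map. *)
  by exists 0 => n; rewrite /= linear0l normr0.
exists `|w| => n; rewrite Ssym (le_trans (cauchy_schwarz _ _))//.
rewrite ler_piMr// -(ler_pXn2r (n := 2))// ?nnegrE//.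
by rewrite expr1n -ip_norm -Ssym SS.
Qed.

Lemma likelihood_ge0 (kappa : R) (T : H -> H) y x :
  0 < kappa -> (0 <= likelihood ip kappa T y x)%E.
Proof. by move=> k0; apply: mule_ge0; [exact: ltW|exact: expeR_ge0]. Qed.

Lemma likelihood_eq0 (kappa : R) (T : H -> H) y x :
  ~ range (sqrt_op ip T) (y - x) -> likelihood ip kappa T y x = 0%E.
Proof.
move=> nr; rewrite /likelihood /weighted_sqnorm asboolF//.
by rewrite lt0_muley ?lte_fin ?oppr_lt0 ?invr_gt0//= mule0.
Qed.

End hilbert.

Theorem corollary8 (R : realType) (H : completeNormedModType R)
    (ip : {dot H for idfun}) (Hip : induces_norm ip)
    (Hsep : separable H) (Hinf : ~ finite_dimensional H)
    (mu : probability (borel H) R) (m : H) (P : {linear H -> H})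
    (mu_gauss : is_gaussian ip mu) (mu_mean : has_mean ip mu m)
    (mu_cov : has_covariance ip mu P)
    (Rop : {linear H -> H}) (R_bounded : bounded_op Rop)
    (R_sym : symmetric_op ip Rop) (R_psd : psd_op ip Rop)
    (PR_comm : forall u : H, P (Rop u) - Rop (P u) = 0)
    (kappa : R) (kappa_gt0 : 0 < kappa) :
  ~ has_positive_lower_bound ip Rop ->
  dense [set y : H |
    (\int[mu]_(x in setT) likelihood ip kappa Rop y x = 0)%E].
Proof.
move=> /unbounded_form_sublevel[g [gM Rg]].
have mV := measurable_bounded_pairing _ _ _ Hip g.
have dV := dense_null_translates _ _ _ _ mu (fun x : borel H => x) _
  (bounded_pairingB _ _ ip g) (bounded_pairingZ _ _ ip g)
  (bounded_pairing_proper _ _ _ Hip _ gM) mV.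
move=> O O0 oO; have [y [Oy /= muy]] := dV O O0 oO.
exists y; split=> //=.
apply: (integral_eq0_off_null_set _ _ _ _ _ _ (mV y) muy) => [x|x Vx].
  exact: likelihood_ge0.
apply: likelihood_eq0 => Rx; apply: Vx.
exact: range_sqrt_sub_bounded_pairing Rg _ Rx.
Qed.
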